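(* For every integer $b\ge 2$ there exists $\epsilon(b)>0$, depending only on $b$, such that $\frac1b-x_-^{(1)}\ge\epsilon(b)$ for every $\lambda>0$, where $x_-^{(1)}$ denotes the smallest fixed point of $F_1$ on $[0,\infty)$, and such that the following holds for every $\lambda>0$. Let $(Y_n)_{n\ge0}$ be the sequence determined by the recursion $$Y_{n+1}=1+\frac{\lambda^2}{\bigl[Y_n^b+\lambda\bigr]\Bigl[1+\frac{\lambda}{Y_{n-1}^b}\Bigr]^b},\qquad n\ge1,$$ with initial condition either $(Y_0,Y_1)=(+\infty,1)$ (full boundary condition) or $(Y_0,Y_1)=\bigl(1,1+\frac{\lambda^2}{1+\lambda}\bigr)$ (empty boundary condition), and let $m=\liminf_n X_n$ and $M=\limsup_n X_n$, where $X_n=Y_n-1$. If $m\ne M$, then $M-m>\epsilon(b)>0$.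
   Context: For $x\ge0$ and $\lambda>0$, $J_2(x)=\dfrac{\lambda}{\bigl(1+\frac{\lambda}{(1+x)^b}\bigr)^b}$ and $F_1(x)=\dfrac{\lambda}{1+\lambda}\,J_2(x)$. When $Y_0=+\infty$, the quantity $\lambda/Y_0^b$ is interpreted as $0$. The sequence $Y_n$ arises from the $C=2$ multi-state hard core model on the rooted $b$-ary tree (state space $\{0,1,2\}$, adjacent states summing to at most $2$, weight proportional to $\lambda^{\sum_v\sigma_v}$): with levels counted from the boundary at level $0$, $Y_n=[1-\mathbb{P}_n(\sigma_r=2)]^{-1}$, where $\mathbb{P}_n$ is the law of the spin at the root $r$ under boundary condition identically $2$ (full) or identically $0$ (empty). *)

(* Defs.v *)
From HB Require Import structures.
From mathcomp Require Import all_boot all_order all_algebra.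
From mathcomp Require Import all_classical all_reals all_analysis.

Set Implicit Arguments.
Unset Strict Implicit.
Unset Printing Implicit Defensive.

Import Order.TTheory GRing.Theory Num.Theory.
Import numFieldNormedType.Exports.

Local Open Scope ring_scope.

Definition J2 (R : realType) (b : nat) (lambda x : R) : R :=
  lambda / (1 + lambda / (1 + x) ^+ b) ^+ b.

Definition F1 (R : realType) (b : nat) (lambda x : R) : R :=
  lambda / (1 + lambda) * J2 b lambda x.

Definition smallest_fixpoint_ge0 (R : realType) (f : R -> R) (x : R) : Prop :=
  [/\ 0 <= x, f x = x & forall y : R, 0 <= y -> f y = y -> x <= y].

(* The sequences take values in \bar R because Y 0 may be +oo. In \bar R,
   +oo ^+ b = +oo for 0 < b and +oo^-1 = 0, so that lambda / Y 0 ^+ b = 0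
   when Y 0 = +oo. *)
Definition hc_recursion (R : realType) (b : nat) (lambda : R)
    (Y : nat -> \bar R) : Prop :=
  forall n : nat, (1 <= n)%N ->
    (Y n.+1 = 1 + (lambda ^+ 2)%:E /
      ((Y n ^+ b + lambda%:E) * (1 + lambda%:E / Y n.-1 ^+ b) ^+ b))%E.

Definition full_boundary (R : realType) (Y : nat -> \bar R) : Prop :=
  Y 0%N = +oo%E /\ Y 1%N = 1%E.

Definition empty_boundary (R : realType) (lambda : R)
    (Y : nat -> \bar R) : Prop :=
  Y 0%N = 1%E /\ Y 1%N = (1 + lambda ^+ 2 / (1 + lambda))%:E.

(* Main.v *)
Require Import Defs.
From HB Require Import structures.
From mathcomp Require Import all_boot all_order all_algebra.
From mathcomp Require Import all_classical all_reals all_analysis.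
From mathcomp Require Import ring lra.
Import Order.TTheory GRing.Theory Num.Theory.
Import numFieldNormedType.Exports.
Local Open Scope ring_scope.

(** Write [X_n = Y_n - 1] and [p x = lambda / ((1 + x)^b + lambda)].  The recursion
    is [X_{n+2} = p X_{n+1} * J2 X_n], where [p] decreases and [J2] increases; the
    two boundary conditions give the same sequence up to one step of delay.  Start
    it from the empty one.  By monotonicity the even terms increase to some [m],
    the odd ones decrease to some [M >= m], these are the liminf and the limsup, and
    the pair is coupled: [m = p M * J2 m] and [M = p m * J2 M].  The theorem follows from two bounds on
    either side of [1/b], uniform in [lambda], with [eps = 1/(16 b)].

    Low side: [F1 (1/b) <= (15/16)/b] ([F1_inv_le]).  As [F1] is monotone it maps
    [[0, (15/16)/b]] to itself, so this interval contains the least fixed point of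
    [F1].  It also contains every even term, since [X_{n+2} <= F1 X_n]; hence
    [m <= (15/16)/b].

    High side: [m < M] forces [M > 1/b] ([coupled_pair_gt_inv]).  The coupling
    equations imply that [logratio] takes equal values at [m] and [M], so it has a
    critical point [c] strictly between them, and criticality reads
    [(b - 1) c (1 + b p c) = 1].  If [M <= 1/b], the left-hand side is monotone up
    to [M], so it is at least [1] at [M]; this is enough to get [F1 M <= M]
    ([F1_le_id]).  But [M = p m * J2 M < p 0 * J2 M = F1 M] because [m > 0].

    Both bounds on [F1] reduce to one-variable inequalities in [p = p x], because
    [lambda = (1 + x)^b p / (1 - p)] and [(1 + x)^b <= b + 1] for [x <= 1/b] give
    [F1 x <= (1 + x)^b (b + 1) p^2 (1 - p)^(b-1) / (1 + b p)] ([F1_le_occ_frac]).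
    These inequalities ([sqr_weight_le_critical], [sqr_weight_le_inv]) come from
    the weighted AM-GM inequality: [p (1 - p)^(b-1)] is bounded by its maximum,
    attained at [1/b], when [p] is of order at most [1/b], and
    [p^2 (1 - p)^(b-1)] by its maximum, attained at [2/(b+1)], for larger [p]. *)

(** * Elementary inequalities *)

Lemma Bernoulli_le (R : realFieldType) (n : nat) (x : R) :
  -1 <= x -> 1 + n%:R * x <= (1 + x) ^+ n.
Proof.
move=> x1; elim: n => [|n IH]; first by rewrite mul0r addr0 expr0.
have h : 0 <= 1 + x by lra.
have n0 : 0 <= n%:R :> R by [].
rewrite exprS; apply: le_trans (ler_wpM2l h IH).
by rewrite -natr1; nra.
Qed.

Lemma expr1D_ge_cubic (R : realFieldType) (n : nat) (x : R) : (2 <= n)%N -> 0 <= x ->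
  1 + n%:R * x + n%:R * (n%:R - 1) / 2 * x ^+ 2
    + n%:R * (n%:R - 1) * (n%:R - 2) / 6 * x ^+ 3 <= (1 + x) ^+ n.
Proof.
move=> n2 x0; elim: n n2 => // n IH n2.
case: (ltnP 1 n) => h; last first.
  have -> : n = 1%N by apply/eqP; rewrite eqn_leq h.
  by rewrite le_eqVlt; apply/orP; left; apply/eqP; field.
have h0 : 0 <= 1 + x by lra.
rewrite [(1 + x) ^+ n.+1]exprS; apply: le_trans (ler_wpM2l h0 (IH h)).
have hn : 2 <= n%:R :> R by rewrite ler_nat.
rewrite -natr1 -subr_ge0.
set N := n%:R in hn *.
have -> : (1 + x) *
    (1 + N * x + N * (N - 1) / 2 * x ^+ 2 + N * (N - 1) * (N - 2) / 6 * x ^+ 3) -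
    (1 + (N + 1) * x + (N + 1) * (N + 1 - 1) / 2 * x ^+ 2 +
     (N + 1) * (N + 1 - 1) * (N + 1 - 2) / 6 * x ^+ 3)
   = N * (N - 1) * (N - 2) / 6 * x ^+ 4 by field.
by rewrite mulr_ge0 ?exprn_ge0// divr_ge0// !mulr_ge0//; lra.
Qed.

(** Multiply [x <= exp (x - 1)] and [y <= exp (y - 1)]: the exponents cancel. *)
Lemma weighted_amgm (R : realType) (j k : nat) (x y : R) : 0 <= x -> 0 <= y ->
  j%:R * x + k%:R * y = (j + k)%:R -> x ^+ j * y ^+ k <= 1.
Proof.
move=> x0 y0 e.
have le_expR (z : R) : z <= expR (z - 1).
  by apply: le_trans (expR_ge1Dx _); rewrite addrC subrK.
apply: (@le_trans _ _ (expR (x - 1) ^+ j * expR (y - 1) ^+ k)).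
  by apply: ler_pM; rewrite ?exprn_ge0//; apply: lerXn2r; rewrite ?nnegrE ?expR_ge0.
rewrite -!expRM_natl -expRD.
have -> : j%:R * (x - 1) + k%:R * (y - 1) = 0 by rewrite natrD in e; lra.
by rewrite expR0.
Qed.

(** The maximum over [[0, 1]] is attained at [t = j / (j + k)]; normalising both
    factors by their values there gives the situation of [weighted_amgm]. *)
Lemma monomial_simplex_le (R : realType) (j k : nat) (t : R) :
  (0 < j)%N -> (0 < k)%N -> 0 <= t <= 1 ->
  t ^+ j * (1 - t) ^+ k <=
  (j%:R / (j + k)%:R) ^+ j * (k%:R / (j + k)%:R) ^+ k.
Proof.
move=> j0 k0 /andP[t0 t1].
have J : 0 < j%:R :> R by rewrite ltr0n.
have K : 0 < k%:R :> R by rewrite ltr0n.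
have JK : 0 < (j + k)%:R :> R by rewrite ltr0n addn_gt0 j0.
set p := j%:R / (j + k)%:R; set q := k%:R / (j + k)%:R.
have p0 : 0 < p by apply: divr_gt0.
have q0 : 0 < q by apply: divr_gt0.
have : (t / p) ^+ j * ((1 - t) / q) ^+ k <= 1.
  apply: weighted_amgm.
  - by rewrite divr_ge0// ltW.
  - by rewrite divr_ge0 ?subr_ge0// ltW.
  - by rewrite /p /q; field; rewrite -?natrD !gt_eqF.
rewrite (expr_div_n t) (expr_div_n (1 - t)) mulrACA -invfM ler_pdivrMr ?mul1r//.
by rewrite mulr_gt0// exprn_gt0.
Qed.

Section Monomials.
Variables (R : realType) (b : nat) (P : R).
Hypotheses (hb : (2 <= b)%N) (P0 : 0 <= P) (P1 : P <= 1).

Lemma monomial1_le : P * (1 - P) ^+ b.-1 * (b%:R - 1) <= ((b%:R - 1) / b%:R) ^+ b.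
Proof.
have B2 : 2 <= b%:R :> R by rewrite ler_nat.
have b1E : (b.-1)%:R = b%:R - 1 :> R by rewrite -subn1 natrB ?(ltnW hb).
have := @monomial_simplex_le R 1 b.-1 P isT.
rewrite -subn1 subn_gt0 hb subn1 add1n prednK ?(ltnW hb)// P0 P1 b1E !expr1.
move=> /(_ isT isT) h.
have -> : ((b%:R - 1) / b%:R) ^+ b = (b%:R - 1) / b%:R * ((b%:R - 1) / b%:R) ^+ b.-1 :> R.
  by rewrite -exprS prednK ?(ltnW hb).
have -> : (b%:R - 1) / b%:R * ((b%:R - 1) / b%:R) ^+ b.-1 =
   (1 / b%:R * ((b%:R - 1) / b%:R) ^+ b.-1) * (b%:R - 1) :> R by ring.
by rewrite ler_wpM2r//; lra.
Qed.

Lemma monomial2_le : P ^+ 2 * (1 - P) ^+ b.-1 * (b%:R + 1) * (b%:R - 1) <=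
  4 * ((b%:R - 1) / (b%:R + 1)) ^+ b.
Proof.
have B2 : 2 <= b%:R :> R by rewrite ler_nat.
have b1E : (b.-1)%:R = b%:R - 1 :> R by rewrite -subn1 natrB ?(ltnW hb).
have := @monomial_simplex_le R 2 b.-1 P isT.
rewrite -subn1 subn_gt0 hb subn1 P0 P1.
have -> : (2 + b.-1)%:R = b%:R + 1 :> R by rewrite natrD b1E; ring.
rewrite b1E => /(_ isT isT) h.
have -> : ((b%:R - 1) / (b%:R + 1)) ^+ b =
   (b%:R - 1) / (b%:R + 1) * ((b%:R - 1) / (b%:R + 1)) ^+ b.-1 :> R.
  by rewrite -exprS prednK ?(ltnW hb).
have -> : 4 * ((b%:R - 1) / (b%:R + 1) * ((b%:R - 1) / (b%:R + 1)) ^+ b.-1) =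
   ((2 / (b%:R + 1)) ^+ 2 * ((b%:R - 1) / (b%:R + 1)) ^+ b.-1) * (b%:R + 1) * (b%:R - 1) :> R.
  by field; rewrite gt_eqF//; lra.
by rewrite !ler_wpM2r//; lra.
Qed.
End Monomials.

(** [x / (1 + x)^b] is nondecreasing up to [x = 1/(b - 1)]: the quotient
    [((1 + x) / (1 + y))^b] is bounded below by Bernoulli. *)
Lemma mul_expr1D_le (R : realFieldType) (b : nat) (x y : R) :
  0 <= x -> x <= y -> (b%:R - 1) * y <= 1 ->
  x * (1 + y) ^+ b <= y * (1 + x) ^+ b.
Proof.
move=> x0 xy yb.
have y1 : 0 < 1 + y by lra.
rewrite -ler_pdivlMr ?exprn_gt0// -mulrA -expr_div_n.
have e : (1 + x) / (1 + y) = 1 + (x - y) / (1 + y) by field; rewrite gt_eqF.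
have h : -1 <= (x - y) / (1 + y) by rewrite ler_pdivlMr//; lra.
rewrite e; apply: le_trans (ler_wpM2l (le_trans x0 xy) (@Bernoulli_le _ b _ h)).
rewrite -subr_ge0.
have -> : y * (1 + b%:R * ((x - y) / (1 + y))) - x =
  (y - x) * (1 - (b%:R - 1) * y) / (1 + y) by field; rewrite gt_eqF.
by rewrite divr_ge0 ?mulr_ge0//; lra.
Qed.

(** Equality holds at [b = 2], and the limit is [exp (3/2)].  The cubic
    truncation of the binomial formula is still exact at [b = 2] and its
    excess over 4 is a positive multiple of [(b - 2) (b - 1) (b + 1)]; the
    quadratic truncation is too weak for large [b]. *)
Lemma shifted_ratio_expr_ge4 (R : realFieldType) (b : nat) : (2 <= b)%N ->
  4 <= ((2 * b%:R + 2) / (2 * b%:R - 1)) ^+ b :> R.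
Proof.
move=> hb.
have B2 : 2 <= b%:R :> R by rewrite ler_nat.
set B := b%:R in B2 *.
have d0 : 0 < 2 * B - 1 by lra.
have -> : (2 * B + 2) / (2 * B - 1) = 1 + 3 / (2 * B - 1).
  by field; rewrite gt_eqF.
have y0 : 0 <= 3 / (2 * B - 1) by rewrite divr_ge0//; lra.
apply: le_trans (@expr1D_ge_cubic _ b _ hb y0).
rewrite -/B -subr_ge0.
have -> : 1 + B * (3 / (2 * B - 1)) + B * (B - 1) / 2 * (3 / (2 * B - 1)) ^+ 2
  + B * (B - 1) * (B - 2) / 6 * (3 / (2 * B - 1)) ^+ 3 - 4 =
  3 / 2 * ((B - 2) * (B - 1) * (B + 1)) / (2 * B - 1) ^+ 3.
  by field; rewrite gt_eqF.
by rewrite divr_ge0 ?exprn_ge0 ?mulr_ge0//; lra.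
Qed.

(** * Bounds on the weight [p^2 (1 - p)^(b-1)] *)

Section WeightBounds.
Variables (R : realType) (b : nat) (P : R).
Hypotheses (hb : (2 <= b)%N) (P0 : 0 <= P) (P1 : P <= 1).

(** With [x = 1/((b - 1)(1 + b P))], the critical abscissa for the value [P], the
    right-hand side is [(1 + x)^-b], and the inequality says that the bound of
    [F1_le_occ_frac] is at most [x] there.  The two maxima are used on either side
    of [P = 1/b]. *)
Lemma sqr_weight_le_critical :
  (b%:R + 1) * (b%:R - 1) * (P ^+ 2 * (1 - P) ^+ b.-1) <=
  ((b%:R - 1) * (1 + b%:R * P) / (b%:R * (1 + (b%:R - 1) * P))) ^+ b.
Proof.
have B2 : 2 <= b%:R :> R by rewrite ler_nat.
have h1 := @monomial1_le R b P hb P0 P1; have h2 := @monomial2_le R b P hb P0 P1.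
set B := b%:R in B2 h1 h2 *.
have D : 0 < 1 + (B - 1) * P by rewrite ltr_pwDl// mulr_ge0//; lra.
have N : 0 < 1 + B * P by rewrite ltr_pwDl// mulr_ge0//; lra.
have [c1|c1] := leP (B * P) 1.
  have -> : (B - 1) * (1 + B * P) / (B * (1 + (B - 1) * P)) =
    (B - 1) / B * (1 + P / (1 + (B - 1) * P)).
    by field; rewrite !gt_eqF//; lra.
  have -> : (B + 1) * (B - 1) * (P ^+ 2 * (1 - P) ^+ b.-1) =
    P * (1 - P) ^+ b.-1 * (B - 1) * ((B + 1) * P) by ring.
  rewrite exprMn; apply: ler_pM => //.
  - by rewrite !mulr_ge0 ?exprn_ge0 ?subr_ge0//; lra.
  - by rewrite mulr_ge0//; lra.
  have y0 : 0 <= P / (1 + (B - 1) * P) by rewrite divr_ge0// ltW.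
  apply: le_trans (@Bernoulli_le _ b _ (le_trans _ y0)); last by lra.
  rewrite -/B mulrA -lerBlDl ler_pdivlMr// -subr_ge0.
  have -> : B * P - ((B + 1) * P - 1) * (1 + (B - 1) * P) =
     (1 - B * P) * (1 + (B - 1) * P) + P * (B - 1) * (1 - P) by ring.
  by rewrite addr_ge0 ?mulr_ge0 ?subr_ge0 ?(ltW D)//; lra.
have -> : (B + 1) * (B - 1) * (P ^+ 2 * (1 - P) ^+ b.-1) =
  P ^+ 2 * (1 - P) ^+ b.-1 * (B + 1) * (B - 1) by ring.
apply: le_trans h2 _.
have -> : (B - 1) * (1 + B * P) / (B * (1 + (B - 1) * P)) =
   (B + 1) * (1 + B * P) / (B * (1 + (B - 1) * P)) * ((B - 1) / (B + 1)).
  by field; rewrite !gt_eqF//; lra.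
rewrite [leRHS]exprMn ler_wpM2r ?exprn_ge0 ?divr_ge0//; try lra.
apply: le_trans (@shifted_ratio_expr_ge4 R b hb) _; rewrite -/B.
apply: lerXn2r; rewrite ?nnegrE.
- by rewrite divr_ge0//; lra.
- by rewrite divr_ge0// mulr_ge0//; lra.
rewrite ler_pdivrMr; last by lra.
rewrite mulrAC ler_pdivlMr; last by rewrite mulr_gt0//; lra.
rewrite -subr_ge0.
have -> : (B + 1) * (1 + B * P) * (2 * B - 1) - (2 * B + 2) * (B * (1 + (B - 1) * P)) =
  (B + 1) * (B * P - 1) by ring.
by rewrite mulr_ge0//; lra.
Qed.

(** This says that the bound of [F1_le_occ_frac] at [x = 1/b] is at most
    [(15/16)/b].  Splitting at [b P = 1] would only give 1 instead of [15/16],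
    since for [b = 2] the second estimate is an equality at [P = 1/2]; a threshold
    between 1 and [16/11] leaves room on both sides, and [5/4] gives [15/16]. *)
Lemma sqr_weight_le_inv :
  (b%:R + 1) * (P ^+ 2 * (1 - P) ^+ b.-1) <=
  15 / 16 / b%:R * (b%:R / (b%:R + 1)) ^+ b * (1 + b%:R * P).
Proof.
have B2 : 2 <= b%:R :> R by rewrite ler_nat.
have h1 := @monomial1_le R b P hb P0 P1; have h2 := @monomial2_le R b P hb P0 P1.
set B := b%:R in B2 h1 h2 *.
have BP0 : 0 <= B * P by rewrite mulr_ge0//; lra.
rewrite -(@ler_pM2r _ (B - 1)); last by lra.
have [c1|c1] := leP (B * P) (5 / 4).
  have -> : (B + 1) * (P ^+ 2 * (1 - P) ^+ b.-1) * (B - 1) =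
    P * (1 - P) ^+ b.-1 * (B - 1) * ((B + 1) * P) by ring.
  apply: (@le_trans _ _ (((B - 1) / B) ^+ b * ((B + 1) * P))).
    by rewrite ler_wpM2r// mulr_ge0//; lra.
  have -> : (B - 1) / B = (B / (B + 1)) * ((B - 1) * (B + 1) / B ^+ 2).
    by field; rewrite !gt_eqF//; lra.
  rewrite exprMn.
  have -> : 15 / 16 / B * (B / (B + 1)) ^+ b * (1 + B * P) * (B - 1) =
    (B / (B + 1)) ^+ b * (15 / 16 / B * (1 + B * P) * (B - 1)) by ring.
  rewrite -[leLHS]mulrA ler_wpM2l ?exprn_ge0 ?divr_ge0//; try lra.
  have BB : 0 < B ^+ 2 by rewrite exprn_gt0//; lra.
  have B4 : 0 < B ^+ 4 by rewrite exprn_gt0//; lra.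
  have le2 : ((B - 1) * (B + 1) / B ^+ 2) ^+ b <= ((B - 1) * (B + 1) / B ^+ 2) ^+ 2.
    apply: ler_wiXn2l => //.
      by rewrite divr_ge0 ?mulr_ge0 ?ltW//; lra.
    by rewrite ler_pdivrMr// mul1r; nra.
  (* 27/16 is the maximum of [(1 - t) (1 + t)^3], taken at [t = 1/b] with [b = 2]. *)
  have le27 : ((B - 1) * (B + 1) / B ^+ 2) ^+ 2 * (B + 1) <= 27 / 16 * (B - 1).
    rewrite -subr_ge0.
    have -> : 27 / 16 * (B - 1) - ((B - 1) * (B + 1) / B ^+ 2) ^+ 2 * (B + 1) =
      (B - 1) * (B - 2) ^+ 2 * (11 * B ^+ 2 + 12 * B + 4) / (16 * B ^+ 4).
      by field; rewrite gt_eqF//; lra.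
    rewrite divr_ge0 ?mulr_ge0 ?sqr_ge0 ?(ltW B4)//; lra.
  apply: (@le_trans _ _ (27 / 16 * (B - 1) * P)).
    rewrite mulrA ler_wpM2r//; apply: le_trans le27.
    by rewrite ler_wpM2r//; lra.
  rewrite -subr_ge0.
  have -> : 15 / 16 / B * (1 + B * P) * (B - 1) - 27 / 16 * (B - 1) * P =
   (B - 1) / B * (3 / 4 * (5 / 4 - B * P)).
    by field; rewrite gt_eqF//; lra.
  by rewrite mulr_ge0 ?divr_ge0//; lra.
have -> : (B + 1) * (P ^+ 2 * (1 - P) ^+ b.-1) * (B - 1) =
  P ^+ 2 * (1 - P) ^+ b.-1 * (B + 1) * (B - 1) by ring.
apply: le_trans h2 _.
have -> : (B - 1) / (B + 1) = B / (B + 1) * ((B - 1) / B).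
  by field; rewrite !gt_eqF//; lra.
have -> : 15 / 16 / B * (B / (B + 1)) ^+ b * (1 + B * P) * (B - 1) =
    (B / (B + 1)) ^+ b * (15 / 16 / B * (1 + B * P) * (B - 1)) by ring.
rewrite exprMn mulrCA ler_wpM2l ?exprn_ge0 ?divr_ge0//; try lra.
have half : ((B - 1) / B) ^+ b.-1 <= 1 / 2.
  have -> : (B - 1) / B = (1 + 1 / (B - 1))^-1.
    by field; rewrite !gt_eqF//; lra.
  rewrite exprVn -[1 / 2]invrK invf_div divr1 lef_pV2 ?posrE//; last first.
    by rewrite exprn_gt0// addr_gt0// divr_gt0//; lra.
  have y0 : 0 <= 1 / (B - 1) by rewrite divr_ge0//; lra.
  apply: le_trans (@Bernoulli_le _ b.-1 _ (le_trans _ y0)); last by lra.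
  have -> : b.-1%:R = B - 1 by rewrite -subn1 natrB ?(ltnW hb).
  by rewrite mulrCA divff ?gt_eqF ?mulr1//; lra.
have -> : ((B - 1) / B) ^+ b = (B - 1) / B * ((B - 1) / B) ^+ b.-1.
  by rewrite -exprS prednK ?(ltnW hb).
have C0 : 0 <= (B - 1) / B by rewrite divr_ge0//; lra.
apply: (@le_trans _ _ ((B - 1) / B * 2)).
  by rewrite mulrCA ler_wpM2l//; lra.
have -> : 15 / 16 / B * (1 + B * P) * (B - 1) = (B - 1) / B * (15 / 16 * (1 + B * P)).
  by field; rewrite gt_eqF//; lra.
by rewrite ler_wpM2l//; lra.
Qed.
End WeightBounds.

(** * The map F1 in terms of the occupation fraction *)

(** The substitution [p = occ_frac b lambda x] replaces the unbounded parameter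
    [lambda] by a variable of [[0, 1]]: [lambda (1 - p) = (1 + x)^b p] and
    [J2 x = lambda (1 - p)^b]. *)
Definition occ_frac (R : realType) (b : nat) (lambda x : R) : R :=
  lambda / ((1 + x) ^+ b + lambda).

Section HardCore.
Variables (R : realType) (b : nat) (lambda : R).
Hypotheses (hb : (2 <= b)%N) (l0 : 0 < lambda).
Local Notation occ := (@occ_frac R b lambda).
Local Notation J2 := (@Defs.J2 R b lambda).
Local Notation F1 := (@Defs.F1 R b lambda).

Lemma occ_frac_den_gt0 (x : R) : 0 <= x -> 0 < (1 + x) ^+ b + lambda.
Proof. by move=> x0; rewrite addr_gt0// exprn_gt0// ltr_wpDr. Qed.

Lemma occ_frac_gt0 (x : R) : 0 <= x -> 0 < occ x.
Proof. by move=> x0; rewrite divr_gt0// occ_frac_den_gt0. Qed.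

Lemma occ_frac_lt1 (x : R) : 0 <= x -> occ x < 1.
Proof.
move=> x0; rewrite ltr_pdivrMr ?occ_frac_den_gt0// mul1r ltrDr.
by rewrite exprn_gt0// ltr_wpDr.
Qed.

Lemma occ_frac_anti (x y : R) : 0 <= x -> x <= y -> occ y <= occ x.
Proof.
move=> x0 xy; have y0 := le_trans x0 xy.
rewrite ler_pM2l// lef_pV2 ?posrE ?occ_frac_den_gt0// lerD2r.
by rewrite lerXn2r ?nnegrE ?addr_ge0// lerD2l.
Qed.

Lemma J2E (x : R) : 0 <= x -> J2 x = lambda * (1 - occ x) ^+ b.
Proof.
move=> x0; have d := occ_frac_den_gt0 _ x0.
have a0 : 0 < (1 + x) ^+ b by rewrite exprn_gt0// ltr_wpDr.
rewrite /Defs.J2 -exprVn; congr (_ * _ ^+ b).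
by rewrite /occ_frac; field; rewrite !gt_eqF// addrC.
Qed.

Lemma J2_mono (x y : R) : 0 <= x -> x <= y -> J2 x <= J2 y.
Proof.
move=> x0 xy; have y0 := le_trans x0 xy.
rewrite !J2E// ler_pM2l//; apply: lerXn2r; last by rewrite lerD2l lerN2 occ_frac_anti.
- by rewrite nnegrE subr_ge0 ltW// occ_frac_lt1.
- by rewrite nnegrE subr_ge0 ltW// occ_frac_lt1.
Qed.

Lemma J2_gt0 (x : R) : 0 <= x -> 0 < J2 x.
Proof. by move=> x0; rewrite J2E// mulr_gt0// exprn_gt0// subr_gt0 occ_frac_lt1. Qed.

Lemma F1_mono (x y : R) : 0 <= x -> x <= y -> F1 x <= F1 y.
Proof. by move=> x0 xy; rewrite ler_wpM2l ?J2_mono// divr_ge0 ?addr_ge0 ?ltW. Qed.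

Lemma occ_frac0 : lambda / (1 + lambda) = occ 0.
Proof. by rewrite /occ_frac addr0 expr1n. Qed.

Lemma expr1D_le_succ (x : R) : 0 <= x -> b%:R * x <= 1 -> (1 + x) ^+ b <= b%:R + 1.
Proof.
move=> x0 bx.
have x1 : 0 < 1 + x by lra.
have b1 : 0 < b%:R + 1 :> R by rewrite ltr_wpDl.
rewrite -lef_pV2 ?posrE ?exprn_gt0// -exprVn.
have -> : (1 + x)^-1 = 1 + - x / (1 + x) by field; rewrite gt_eqF.
have h : -1 <= - x / (1 + x) by rewrite ler_pdivlMr//; lra.
apply: le_trans (@Bernoulli_le _ b _ h).
rewrite -subr_ge0.
have -> : 1 + b%:R * (- x / (1 + x)) - (b%:R + 1)^-1 =
  b%:R * (1 - b%:R * x) / ((1 + x) * (b%:R + 1)).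
  by field; rewrite !gt_eqF.
by rewrite divr_ge0 ?mulr_ge0 ?subr_ge0//; lra.
Qed.

(** [F1 x] equals [(1 + x)^b p (1 - p)^(b-1) * (lambda / (1 + lambda))], and the
    last factor is at most [(b + 1) p / (1 + b p)] exactly when
    [(1 + x)^b <= b + 1]. *)
Lemma F1_le_occ_frac (x : R) : 0 <= x -> b%:R * x <= 1 ->
  F1 x <= (1 + x) ^+ b *
    ((b%:R + 1) * (occ x ^+ 2 * (1 - occ x) ^+ b.-1) / (1 + b%:R * occ x)).
Proof.
move=> x0 bx; have d := occ_frac_den_gt0 _ x0; have a0 := expr1D_le_succ _ x0 bx.
have p0 := occ_frac_gt0 _ x0; have p1 := occ_frac_lt1 _ x0.
have e : lambda * (1 - occ x) = (1 + x) ^+ b * occ x.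
  by rewrite /occ_frac; field; rewrite gt_eqF.
have -> : F1 x = (1 + x) ^+ b * occ x * (1 - occ x) ^+ b.-1 * (lambda / (1 + lambda)).
  rewrite /Defs.F1 J2E//.
  have -> : (1 - occ x) ^+ b = (1 - occ x) * (1 - occ x) ^+ b.-1.
    by rewrite -exprS prednK// ltnW.
  by rewrite (mulrA lambda) e; ring.
have -> : (1 + x) ^+ b *
    ((b%:R + 1) * (occ x ^+ 2 * (1 - occ x) ^+ b.-1) / (1 + b%:R * occ x)) =
  (1 + x) ^+ b * occ x * (1 - occ x) ^+ b.-1 * ((b%:R + 1) * occ x / (1 + b%:R * occ x)).
  by field; rewrite gt_eqF// ltr_pwDl// mulr_ge0// ltW.
rewrite ler_wpM2l//.
  apply: mulr_ge0; last by rewrite exprn_ge0// subr_ge0 ltW.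
  by apply: mulr_ge0; [rewrite exprn_ge0// addr_ge0 | rewrite ltW].
have n0 : 0 <= b%:R :> R by [].
have q : 0 < (1 + x) ^+ b + lambda + b%:R * lambda.
  by rewrite ltr_wpDr// mulr_ge0// ltW.
have -> : (b%:R + 1) * occ x / (1 + b%:R * occ x) =
  (b%:R + 1) * lambda / ((1 + x) ^+ b + lambda + b%:R * lambda).
  by rewrite /occ_frac; field; rewrite !gt_eqF.
rewrite [in leRHS]mulrAC [leRHS]mulrC ler_pM2l//.
have l1 : 0 < 1 + lambda by rewrite addr_gt0.
rewrite ler_pdivlMr// mulrC ler_pdivrMr//; lra.
Qed.

Lemma F1_inv_le : F1 b%:R^-1 <= 15 / 16 / b%:R.
Proof.
have b0 : 0 < b%:R :> R by rewrite ltr0n (ltnW hb).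
have x0 : 0 <= b%:R^-1 :> R by rewrite invr_ge0 ltW.
have bx : b%:R * b%:R^-1 <= 1 :> R by rewrite divff ?gt_eqF.
apply: le_trans (F1_le_occ_frac _ x0 bx) _.
have p0 := occ_frac_gt0 _ x0; have p1 := occ_frac_lt1 _ x0.
have k := @sqr_weight_le_inv R b _ hb (ltW p0) (ltW p1).
have d : 0 < 1 + b%:R * occ b%:R^-1 by rewrite ltr_pwDl// mulr_ge0// ltW.
rewrite -ler_pdivrMr// in k.
apply: le_trans (ler_wpM2l _ k) _; first by rewrite exprn_ge0 ?addr_ge0.
rewrite le_eqVlt; apply/orP; left; apply/eqP.
have -> : b%:R / (b%:R + 1) = (1 + b%:R^-1)^-1 :> R.
  by field; rewrite !gt_eqF//; lra.
rewrite exprVn mulrCA divff ?mulr1// gt_eqF// exprn_gt0//; lra.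
Qed.

(** By [mul_expr1D_le] the ratio [x / (1 + x)^b] is at least its value at the
    critical abscissa [y = 1/((b - 1)(1 + b p)) <= x], where
    [sqr_weight_le_critical] applies. *)
Lemma F1_le_id (x : R) : 0 < x -> b%:R * x <= 1 ->
  1 <= (b%:R - 1) * x * (1 + b%:R * occ x) -> F1 x <= x.
Proof.
move=> x0 bx hx.
have B2 : 2 <= b%:R :> R by rewrite ler_nat.
apply: le_trans (F1_le_occ_frac _ (ltW x0) bx) _.
have p0 := occ_frac_gt0 _ (ltW x0); have p1 := occ_frac_lt1 _ (ltW x0).
have k := @sqr_weight_le_critical R b _ hb (ltW p0) (ltW p1).
set p := occ x in hx p0 p1 k *; set B := b%:R in B2 bx hx k *.
have d : 0 < 1 + B * p by rewrite ltr_pwDl// mulr_ge0//; lra.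
have d' : 0 < 1 + (B - 1) * p by rewrite ltr_pwDl// mulr_ge0//; lra.
have B1 : 0 < B - 1 by lra.
pose y := ((B - 1) * (1 + B * p))^-1.
have y0 : 0 < y by rewrite invr_gt0 mulr_gt0.
have yx : y <= x.
  by rewrite /y -[leLHS]mul1r ler_pdivrMr ?mulr_gt0// mulrCA mulrA.
have r := @mul_expr1D_le R b y x (ltW y0) yx.
have ye : (B - 1) * (1 + B * p) / (B * (1 + (B - 1) * p)) = (1 + y)^-1.
  by rewrite /y; field; rewrite !gt_eqF//; nra.
rewrite ye exprVn in k.
have Y : 0 < (1 + y) ^+ b by rewrite exprn_gt0// addr_gt0.
rewrite -[leRHS](mulfK (lt0r_neq0 Y)).
have {}r : (1 + x) ^+ b * y <= x * (1 + y) ^+ b.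
  by rewrite mulrC; apply: r; rewrite -/B; nra.
apply: (@le_trans _ _ ((1 + x) ^+ b * y * ((1 + y) ^+ b)^-1)); last first.
  by rewrite ler_wpM2r// invr_ge0 ltW.
rewrite -[leRHS]mulrA ler_wpM2l ?exprn_ge0 ?addr_ge0 ?(ltW x0)//.
have -> : (B + 1) * (p ^+ 2 * (1 - p) ^+ b.-1) / (1 + B * p) =
  y * ((B + 1) * (B - 1) * (p ^+ 2 * (1 - p) ^+ b.-1)).
  by rewrite /y; field; rewrite !gt_eqF.
by rewrite ler_pM2l.
Qed.

Lemma mul_occ_frac_mono (x y : R) : 0 <= x -> x <= y -> b%:R * y <= 1 ->
  x * occ x <= y * occ y.
Proof.
move=> x0 xy yb; have y0 := le_trans x0 xy.
have r : x * (1 + y) ^+ b <= y * (1 + x) ^+ b by apply: mul_expr1D_le => //; lra.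
rewrite /occ_frac !mulrA ler_pdivrMr ?occ_frac_den_gt0// mulrAC ler_pdivlMr ?occ_frac_den_gt0//.
rewrite -!mulrA [_ * (lambda * _)]mulrCA [leRHS]mulrCA ler_pM2l//.
by rewrite !mulrDr lerD// ler_wpM2r// ltW.
Qed.

(** * Coupled pairs *)

(** A coupled pair is a solution of [m = p M * J2 m] and [M = p m * J2 M].

    [logratio] is the logarithm of
    [x ((1 + x)^b + lambda)^(b-1) / (1 + x)^(b^2)], the function obtained by
    separating the variables in the quotient of the two equations. *)
Definition logratio (x : R) := ln x + (b%:R - 1) * ln ((1 + x) ^+ b + lambda)
   - b%:R ^+ 2 * ln (1 + x).

Definition dlogratio (x : R) := x^-1
  + (b%:R - 1) * (b%:R * (1 + x) ^+ b.-1 / ((1 + x) ^+ b + lambda))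
  - b%:R ^+ 2 / (1 + x).

Lemma is_derive_logratio (x : R) : 0 < x -> is_derive x 1 logratio (dlogratio x).
Proof.
move=> x0.
have d := occ_frac_den_gt0 _ (ltW x0).
have x1 : 0 < 1 + x by lra.
pose h : R -> R := cst 1 + id.
pose g : R -> R := h ^+ b + cst lambda.
have gE (y : R) : g y = (1 + y) ^+ b + lambda by rewrite /g /h exprfctE.
have dlnx : is_derive x 1 (@ln R) x^-1 by exact: is_derive1_ln.
have dlnh : is_derive (h x) 1 (@ln R) (1 + x)^-1 by exact: is_derive1_ln.
have dlng : is_derive (g x) 1 (@ln R) (g x)^-1 by apply: is_derive1_ln; rewrite gE.
have dh : is_derive x 1 h (0 + 1) by exact: is_deriveD.
have dg : is_derive x 1 g ((b%:R * h x ^+ b.-1) *: (0 + 1) + 0).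
  exact: is_deriveD.
have -> : logratio =
    @ln R + (b%:R - 1) *: (@ln R \o g) - (b%:R ^+ 2) *: (@ln R \o h).
  by apply/funext => y; rewrite /logratio -gE.
apply: is_derive_eq.
rewrite /dlogratio -gE /GRing.scale /=; ring.
Qed.

(** The right-hand side is symmetric in [m] and [M]; this is why [logratio] agrees
    at the two members of a coupled pair. *)
Lemma logratio_coupled (m M : R) : 0 < m -> 0 < M -> m = occ M * J2 m ->
  logratio m = ln lambda + ln lambda - ln ((1 + m) ^+ b + lambda)
     - ln ((1 + M) ^+ b + lambda).
Proof.
move=> m0 M0 mE.
have dm := occ_frac_den_gt0 _ (ltW m0); have dM := occ_frac_den_gt0 _ (ltW M0).
have am : 0 < 1 + m by rewrite addr_gt0.
have e : 1 - occ m = (1 + m) ^+ b / ((1 + m) ^+ b + lambda).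
  by rewrite /occ_frac; field; rewrite gt_eqF.
have : ln m = ln (lambda / ((1 + M) ^+ b + lambda) *
   (lambda * ((1 + m) ^+ b / ((1 + m) ^+ b + lambda)) ^+ b)).
  by rewrite -e -J2E ?(ltW m0)// -[LHS]/(ln m) {1}mE.
set p := lambda / _; set q := _ / _.
have p0 : 0 < p by rewrite divr_gt0.
have q0 : 0 < q by rewrite divr_gt0 ?exprn_gt0.
have lnX (x : R) : 0 < x -> ln (x ^+ b) = b%:R * ln x.
  by move=> x0; rewrite lnXn// mulr_natl.
have lq : ln (lambda * q ^+ b) = ln lambda + b%:R * ln q.
  by rewrite lnM ?lnX// posrE exprn_gt0.
have -> : ln (p * (lambda * q ^+ b)) = ln p + (ln lambda + b%:R * ln q).
  by rewrite lnM ?lq// posrE mulr_gt0// exprn_gt0.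
rewrite /p /q !ln_div ?posrE ?exprn_gt0// lnX//.
rewrite /logratio => ->; ring.
Qed.

Lemma coupled_pair_gt_inv (m M : R) : 0 <= m -> m < M ->
  m = occ M * J2 m -> M = occ m * J2 M -> 1 < b%:R * M.
Proof.
move=> m0' mM mE ME; rewrite ltNge; apply/negP => bM.
have M0 := le_lt_trans m0' mM.
have m0 : 0 < m by rewrite mE mulr_gt0 ?occ_frac_gt0 ?J2_gt0// ltW.
have dl (x : R) : x \in `]m, M[ -> is_derive x 1 logratio (dlogratio x).
  by rewrite in_itv/= => /andP[mx _]; apply: is_derive_logratio; exact: lt_trans mx.
have ct : {within `[m, M], continuous logratio}%classic.
  apply: derivable_within_continuous => x; rewrite in_itv/= => /andP[mx _].
  by apply: ex_derive; apply: is_derive_logratio; exact: lt_le_trans mx.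
(* The mean value theorem in the form of Rolle: the two end values agree. *)
have [c] := MVT mM dl ct.
rewrite in_itv/= (logratio_coupled M m)// (logratio_coupled m M)// => /andP[mc cM] /esym/eqP.
have -> : ln lambda + ln lambda - ln ((1 + M) ^+ b + lambda) -
   ln ((1 + m) ^+ b + lambda) - (ln lambda + ln lambda -
   ln ((1 + m) ^+ b + lambda) - ln ((1 + M) ^+ b + lambda)) = 0 by ring.
rewrite mulf_eq0 (subr_eq0 M m) (gt_eqF mM) orbF => /eqP dc.
have c0 : 0 < c := lt_trans m0 mc.
(* Clearing denominators in the vanishing of the derivative. *)
have crit : (b%:R - 1) * c * (1 + b%:R * occ c) = 1.
  have d := occ_frac_den_gt0 _ (ltW c0).
  have c1 : 0 < 1 + c by rewrite addr_gt0.
  apply/eqP; rewrite -subr_eq0; apply/eqP.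
  transitivity (- (c * (1 + c)) * dlogratio c); last by rewrite dc mulr0.
  have eb : (1 + c) ^+ b = (1 + c) * (1 + c) ^+ b.-1.
    by rewrite -exprS prednK// ltnW.
  rewrite /dlogratio /occ_frac eb in d *.
  by field; rewrite !gt_eqF.
have : F1 M <= M.
  apply: F1_le_id => //; rewrite -[leLHS]crit.
  have h := mul_occ_frac_mono _ _ (ltW c0) (ltW cM) bM.
  have B1 : 0 <= b%:R - 1 :> R by rewrite subr_ge0 ler1n ltnW.
  have b0 : 0 <= b%:R :> R by [].
  rewrite -!(mulrA (b%:R - 1)) ler_wpM2l// !mulrDr !mulr1 lerD ?(ltW cM)//.
  by rewrite !(mulrCA _ b%:R) ler_wpM2l.
apply/negP; rewrite -ltNge {1}ME ltr_pM2r ?J2_gt0 ?(ltW M0)//.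
rewrite ltr_pM2l// ltf_pV2 ?posrE ?occ_frac_den_gt0 ?addr_gt0// ltrD2r.
by rewrite exprn_egt1 ?ltrDl// -lt0n ltnW.
Qed.

End HardCore.

(** * Lower and upper limits of an extended real sequence *)

Section Limits.
Local Open Scope classical_set_scope.
Local Open Scope ring_scope.

Lemma limn_einf_eq (R : realType) (X : nat -> \bar R) (u : nat -> R) (l : R) :
  u @ \oo --> l ->
  (forall n, exists2 j, (n <= j)%N & (X j <= l%:E)%E) ->
  (forall k, exists N, forall j, (N <= j)%N -> ((u k)%:E <= X j)%E) ->
  limn_einf X = l%:E.
Proof.
move=> ul Xl uX; apply/eqP; rewrite eq_le limn_einf_lim; apply/andP; split.
  apply: lime_le; first exact: is_cvg_einfs.
  apply: nearW => n; have [j nj Xj] := Xl n.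
  by apply: ge_ereal_inf; exists (X j) => //; exists j.
have ul' : (EFin \o u) @ \oo --> l%:E by apply: cvg_EFin => //; exact: nearW.
rewrite -(cvg_lim _ ul')//; apply: lime_le; first by apply/cvg_ex; exists l%:E.
apply: nearW => k; have [N uN] := uX k.
have sX := @cvg_einfs_sup _ X; rewrite (cvg_lim _ sX)//.
apply: le_ereal_sup_tmp; exists (einfs X N); first by exists N.
by apply: le_ereal_inf_tmp => _ [j /= Nj <-]; exact: uN.
Qed.

Lemma limn_esup_eq (R : realType) (X : nat -> \bar R) (u : nat -> R) (l : R) :
  u @ \oo --> l ->
  (forall n, exists2 j, (n <= j)%N & (l%:E <= X j)%E) ->
  (forall k, exists N, forall j, (N <= j)%N -> (X j <= (u k)%:E)%E) ->
  limn_esup X = l%:E.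
Proof.
move=> ul Xl uX; apply: oppe_inj; rewrite -limn_einfN -EFinN.
apply: (@limn_einf_eq _ _ (fun n => - u n)); first exact: cvgN.
- by move=> n; have [j nj Xj] := Xl n; exists j => //=; rewrite EFinN leeN2.
- move=> k; have [N uN] := uX k; exists N => j /uN.
  by rewrite /= EFinN leeN2.
Qed.

End Limits.

(** * The orbit of the recursion *)

Section Orbit.
Local Open Scope classical_set_scope.
Local Open Scope ring_scope.
Variables (R : realType) (b : nat) (lambda : R).
Hypotheses (hb : (2 <= b)%N) (l0 : 0 < lambda).
Local Notation occ := (@occ_frac R b lambda).
Local Notation J2 := (@Defs.J2 R b lambda).
Local Notation F1 := (@Defs.F1 R b lambda).

(** The pair holds two consecutive terms. *)
Definition hc_step (p : R * R) : R * R := (p.2, occ p.2 * J2 p.1).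

(** [Y_n - 1] for the empty boundary condition.  For the full one, [X_1 = 0] and
    [X_2 = lambda^2 / (1 + lambda)], so that [X_(n+1)] is the same sequence. *)
Definition hc_orbit (n : nat) : R :=
  (iter n hc_step (0, lambda ^+ 2 / (1 + lambda))).1.
Local Notation o := hc_orbit.

Lemma hc_orbitSS n : o n.+2 = occ (o n.+1) * J2 (o n).
Proof. by []. Qed.

Lemma hc_orbit1 : o 1 = occ 0 * lambda.
Proof. by rewrite /hc_orbit/= -occ_frac0; ring. Qed.

Lemma hc_orbit_ge0 n : 0 <= o n.
Proof.
suff : 0 <= o n /\ 0 <= o n.+1 by case.
elim: n => [|n [h0 h1]].
  by split=> //; rewrite hc_orbit1 ltW// mulr_gt0// occ_frac_gt0.
by split=> //; rewrite hc_orbitSS ltW// mulr_gt0 ?occ_frac_gt0 ?J2_gt0.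
Qed.

Lemma J2_le (x : R) : 0 <= x -> J2 x <= lambda.
Proof.
move=> x0; rewrite J2E// -[leRHS]mulr1 ler_pM2l//.
apply: exprn_ile1; first by rewrite subr_ge0 ltW// occ_frac_lt1.
by rewrite lerBlDr lerDl ltW// occ_frac_gt0.
Qed.

Lemma hc_step_le (x x' y y' : R) : 0 <= x -> x <= x' -> 0 <= y' -> y' <= y ->
  occ y * J2 x <= occ y' * J2 x'.
Proof.
move=> x0 xx y0 yy; have yy0 := le_trans y0 yy.
apply: ler_pM; [by rewrite ltW// occ_frac_gt0|by rewrite ltW// J2_gt0
  |exact: occ_frac_anti|exact: J2_mono].
Qed.

(** The map [(y, x) -> p y * J2 x] is antitone in [y] and monotone in [x], so each
    of the two monotonicities propagates the other; the induction starts because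
    [o 0 = 0] is the least possible value and [o 1 = p 0 * lambda] bounds all
    values of the map. *)
Lemma hc_orbit_mono k :
  o k.*2 <= o k.+1.*2 /\ o k.+1.*2.+1 <= o k.*2.+1.
Proof.
elim: k => [|k [e d]].
  split; first exact: hc_orbit_ge0.
  change (occ (o 2) * J2 (o 1) <= o 1); rewrite [leRHS]hc_orbit1.
  apply: ler_pM; [by rewrite ltW// occ_frac_gt0// hc_orbit_ge0
   |by rewrite ltW// J2_gt0// hc_orbit_ge0| |].
    by apply: occ_frac_anti => //; exact: hc_orbit_ge0.
  by apply: J2_le; exact: hc_orbit_ge0.
have e' : o k.+1.*2 <= o k.+2.*2.
  change (occ (o k.*2.+1) * J2 (o k.*2) <= occ (o k.+1.*2.+1) * J2 (o k.+1.*2)).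
  by apply: hc_step_le => //; exact: hc_orbit_ge0.
split=> //.
change (occ (o k.+2.*2) * J2 (o k.+1.*2.+1) <= occ (o k.+1.*2) * J2 (o k.*2.+1)).
by apply: hc_step_le => //; exact: hc_orbit_ge0.
Qed.

Lemma hc_orbit_even_odd k : o k.*2 <= o k.*2.+1 /\ o k.+1.*2 <= o k.*2.+1.
Proof.
elim: k => [|k [e d]].
  split; first exact: hc_orbit_ge0.
  change (occ (o 1) * J2 (o 0) <= o 1); rewrite [leRHS]hc_orbit1.
  apply: ler_pM; [by rewrite ltW// occ_frac_gt0// hc_orbit_ge0|by rewrite ltW// J2_gt0| |].
    by apply: occ_frac_anti => //; exact: hc_orbit_ge0.
  exact: J2_le.
have e' : o k.+1.*2 <= o k.+1.*2.+1.
  change (occ (o k.*2.+1) * J2 (o k.*2) <= occ (o k.+1.*2) * J2 (o k.*2.+1)).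
  by apply: hc_step_le => //; exact: hc_orbit_ge0.
split=> //.
change (occ (o k.+1.*2.+1) * J2 (o k.+1.*2) <= occ (o k.+1.*2) * J2 (o k.*2.+1)).
by apply: hc_step_le => //; exact: hc_orbit_ge0.
Qed.

Lemma hc_even_nd : nondecreasing_seq (fun k => o k.*2).
Proof. by apply/nondecreasing_seqP => k; case: (hc_orbit_mono k). Qed.

Lemma hc_odd_ni : nonincreasing_seq (fun k => o k.*2.+1).
Proof. by apply/nonincreasing_seqP => k; case: (hc_orbit_mono k). Qed.

Lemma hc_orbit_between n : o n./2.*2 <= o n <= o n./2.*2.+1.
Proof.
have [h _] := hc_orbit_even_odd n./2.
have := odd_double_half n; case: (odd n) => /= e.
  have -> : o n = o n./2.*2.+1 by rewrite -[in LHS]e.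
  by rewrite h lexx.
have -> : o n = o n./2.*2 by rewrite -[in LHS]e.
by rewrite lexx h.
Qed.

Lemma is_cvg_hc_even : cvgn (fun k => o k.*2).
Proof.
apply: nondecreasing_is_cvgn; first exact: hc_even_nd.
exists (o 1) => _ [k _ <-]; have [h _] := hc_orbit_even_odd k.
exact: le_trans h (hc_odd_ni 0%N k isT).
Qed.

Lemma is_cvg_hc_odd : cvgn (fun k => o k.*2.+1).
Proof.
apply: nonincreasing_is_cvgn; first exact: hc_odd_ni.
by exists 0 => _ [k _ <-]; exact: hc_orbit_ge0.
Qed.

Lemma cvg_hc_step (u v : nat -> R) (x y : R) : 0 <= x -> 0 <= y ->
  u @ \oo --> x -> v @ \oo --> y ->
  (occ (v n) * J2 (u n)) @[n --> \oo] --> occ y * J2 x.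
Proof.
move=> x0 y0 ux vy.
have pw (w : nat -> R) (z : R) : w @ \oo --> z ->
    ((1 + w n) ^+ b) @[n --> \oo] --> (1 + z) ^+ b.
  move=> wz; have w1 : (1 + w n) @[n --> \oo] --> 1 + z.
    by apply: cvgD => //; exact: cvg_cst.
  exact: (continuous_cvg _ (@exprn_continuous R b (1 + z)) w1).
have ax : (1 + x) ^+ b != 0 by rewrite gt_eqF// exprn_gt0// ltr_wpDr.
apply: cvgM; apply: cvgM; try exact: cvg_cst.
  apply: cvgV; first by rewrite gt_eqF// occ_frac_den_gt0.
  by apply: cvgD; [exact: pw|exact: cvg_cst].
apply: cvgV.
  by rewrite gt_eqF// exprn_gt0// addr_gt0// divr_gt0// exprn_gt0// ltr_wpDr.
apply: (@pw (fun n => lambda / (1 + u n) ^+ b)).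
by apply: cvgM; [exact: cvg_cst|apply: cvgV => //; exact: pw].
Qed.

Lemma hc_orbit_limits : exists m M : R,
  [/\ (fun k => o k.*2) @ \oo --> m, (fun k => o k.*2.+1) @ \oo --> M,
      forall k, 0 <= o k.*2 <= m, forall k, M <= o k.*2.+1 &
      [/\ 0 <= m, m <= M, m = occ M * J2 m & M = occ m * J2 M]].
Proof.
pose u k := o k.*2; pose v k := o k.*2.+1.
have cu := is_cvg_hc_even; have cv := is_cvg_hc_odd.
have um : u @ \oo --> limn u := cu.
have vM : v @ \oo --> limn v := cv.
have ule k : u k <= limn u := nondecreasing_cvgn_le hc_even_nd cu k.
have vge k : limn v <= v k := nonincreasing_cvgn_ge hc_odd_ni cv k.
have m0 : 0 <= limn u := le_trans (hc_orbit_ge0 0) (ule 0%N).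
have mM : limn u <= limn v.
  apply: ler_lim => //; apply: nearW => k; exact: (hc_orbit_even_odd k).1.
have M0 := le_trans m0 mM.
exists (limn u), (limn v); split=> //.
  by move=> k; rewrite hc_orbit_ge0 (ule k).
split=> //.
  apply: (cvg_unique _ (_ : (fun k => u k.+1) @ \oo --> _)) => //.
    by rewrite cvg_shiftS.
  exact: cvg_hc_step.
apply: (cvg_unique _ (_ : (fun k => v k.+1) @ \oo --> _)) => //.
  by rewrite cvg_shiftS.
apply: (@cvg_hc_step v (fun k => u k.+1)) => //.
by rewrite cvg_shiftS.
Qed.

(** * Separation of the two limits by [1/b] *)

(** The Knaster-Tarski argument: the least fixed point is the infimum of the
    points [u] with [f u <= u]. *)
Lemma least_fixpoint_exists (f : R -> R) (y : R) :
  (forall u v, 0 <= u -> u <= v -> f u <= f v) -> (forall u, 0 <= u -> 0 <= f u) ->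
  0 <= y -> f y <= y -> exists x, smallest_fixpoint_ge0 f x /\ x <= y.
Proof.
move=> fm f0 y0 fy.
pose S := [set u : R | 0 <= u /\ f u <= u]%classic.
have Sy : S y by [].
have Slb : has_lbound S by exists 0 => u [].
have infS u : S u -> inf S <= u by move=> Su; apply: ge_inf.
have i0 : 0 <= inf S by apply: lb_le_inf; [exists y | move=> u []].
have fi : f (inf S) <= inf S.
  apply: lb_le_inf; first by exists y.
  by move=> u Su; have [u0 fu] := Su; apply: le_trans fu; apply: fm => //; exact: infS.
exists (inf S); split; last exact: infS.
split=> //; last by move=> u u0 fu; apply: infS; split=> //; rewrite fu.
apply/eqP; rewrite eq_le fi/=; apply: infS; split; first exact: f0.
by apply: fm => //; exact: f0.
Qed.

Lemma F1_le_subinv (x : R) : 0 <= x -> x <= 15 / 16 / b%:R -> F1 x <= 15 / 16 / b%:R.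
Proof.
move=> x0 xb; apply: le_trans (F1_inv_le R b lambda hb l0).
apply: F1_mono => //; apply: le_trans xb _.
by rewrite -[leRHS]mul1r ler_wpM2r ?invr_ge0//; lra.
Qed.

(** One step of the recursion is at most [F1], because [p y <= p 0]. *)
Lemma hc_orbit_even_le k : o k.*2 <= 15 / 16 / b%:R.
Proof.
elim: k => [|k IH]; first by rewrite divr_ge0//; lra.
rewrite doubleS hc_orbitSS; apply: le_trans (F1_le_subinv _ (hc_orbit_ge0 _) IH).
rewrite /Defs.F1 (occ_frac0 R b lambda) ler_wpM2r//.
  by rewrite ltW// J2_gt0// hc_orbit_ge0.
by apply: occ_frac_anti => //; exact: hc_orbit_ge0.
Qed.

(** * From the extended real recursion to the orbit *)

Lemma hc_recursion_EFin (x y : R) : 0 <= x -> 0 <= y ->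
  (1 + (lambda ^+ 2)%:E /
      (((1 + y)%:E ^+ b + lambda%:E) * (1 + lambda%:E / (1 + x)%:E ^+ b) ^+ b))%E
  = (1 + occ y * J2 x)%:E.
Proof.
move=> x0 y0.
have ax : 0 < (1 + x) ^+ b by rewrite exprn_gt0// ltr_wpDr.
have dy := occ_frac_den_gt0 R b lambda l0 _ y0.
have e : 0 < (1 + lambda / (1 + x) ^+ b) ^+ b.
  by rewrite exprn_gt0// addr_gt0// divr_gt0.
rewrite -!EFin_expe inver gt_eqF// -EFinM -!EFinD -EFin_expe -EFinM.
rewrite inver gt_eqF ?mulr_gt0// -EFinM; congr (_%:E); congr (1 + _).
by rewrite /occ_frac /Defs.J2; field; rewrite !gt_eqF.
Qed.

Lemma hc_recursion_orbit (Y : nat -> \bar R) (s : nat) :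
  hc_recursion b lambda Y ->
  Y s = 1%E -> Y s.+1 = (1 + lambda ^+ 2 / (1 + lambda))%:E ->
  forall n, Y (n + s)%N = (1 + o n)%:E.
Proof.
move=> rec Y0 Y1 n.
suff : Y (n + s)%N = (1 + o n)%:E /\ Y (n.+1 + s)%N = (1 + o n.+1)%:E by case.
elim: n => [|n [h0 h1]]; first by rewrite add0n add1n Y0 Y1 addr0.
split=> //; rewrite hc_orbitSS -hc_recursion_EFin ?hc_orbit_ge0//.
by rewrite -h0 -h1 addSn rec.
Qed.

Lemma boundary_hc_orbit (Y : nat -> \bar R) : hc_recursion b lambda Y ->
  full_boundary Y \/ empty_boundary lambda Y ->
  exists s, forall n, Y (n + s)%N = (1 + o n)%:E.
Proof.
move=> rec [[Y0 Y1]|[Y0 Y1]]; last by exists 0%N; exact: hc_recursion_orbit.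
exists 1%N; apply: hc_recursion_orbit => //.
have yb : (+oo ^+ b)%E = +oo%E :> \bar R.
  case: b hb => // k _; elim: k => // k IH; by rewrite expeS IH.
rewrite rec// Y0 Y1 yb invey mule0 adde0.
have l1 : 0 < 1 + lambda by rewrite addr_gt0.
rewrite -!EFin_expe !expr1n mule1 -EFinD inver gt_eqF// -EFinM.
Qed.

Lemma limn_einf_esup_orbit (X : nat -> \bar R) (s : nat) (m M : R) :
  (forall n, X (n + s)%N = (o n)%:E) ->
  (fun k => o k.*2) @ \oo --> m -> (fun k => o k.*2.+1) @ \oo --> M ->
  (forall k, o k.*2 <= m) -> (forall k, M <= o k.*2.+1) ->
  limn_einf X = m%:E /\ limn_esup X = M%:E.
Proof.
move=> XE om oM ole oge.
have XE' j k : (k.*2 + s <= j)%N -> exists2 i, (k <= i./2)%N & X j = (o i)%:E.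
  move=> kj; exists (j - s)%N.
    by rewrite -(doubleK k) half_leq// leq_subRL ?(leq_trans (leq_addl _ _) kj)// addnC.
  by rewrite -XE subnK// (leq_trans (leq_addl _ _) kj).
split.
  apply: (limn_einf_eq _ _ _ _ om).
  - move=> n; exists (n.*2 + s)%N; last by rewrite XE lee_fin.
    by rewrite -addnn -addnA leq_addr.
  - move=> k; exists (k.*2 + s)%N => j /XE' [i ki ->]; rewrite lee_fin.
    have /andP[+ _] := hc_orbit_between i; apply: le_trans.
    exact: hc_even_nd ki.
apply: (limn_esup_eq _ _ _ _ oM).
- move=> n; exists (n.*2.+1 + s)%N; last by rewrite XE lee_fin.
  by rewrite -addnn -addSn -addnA leqW// leq_addr.
- move=> k; exists (k.*2 + s)%N => j /XE' [i ki ->]; rewrite lee_fin.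
  have /andP[_ +] := hc_orbit_between i; move/le_trans; apply.
  exact: hc_odd_ni ki.
Qed.

End Orbit.

Theorem theorem3p3 (R : realType) (b : nat) (hb : (2 <= b)%N) :
  exists eps : R,
    [/\ 0 < eps,
        forall lambda : R, 0 < lambda ->
          exists x : R, smallest_fixpoint_ge0 (F1 b lambda) x /\
            eps <= b%:R^-1 - x
      & forall (lambda : R) (Y : nat -> \bar R), 0 < lambda ->
          hc_recursion b lambda Y ->
          full_boundary Y \/ empty_boundary lambda Y ->
          let X := fun n : nat => (Y n - 1)%E in
          let m := limn_einf X in
          let M := limn_esup X in
          m <> M -> (eps%:E < M - m)%E].
Proof.
have b0 : 0 < b%:R :> R by rewrite ltr0n ltnW.
have bV : 0 < b%:R^-1 :> R by rewrite invr_gt0.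
exists (1 / 16 / b%:R); split; first by rewrite divr_gt0.
  move=> lambda l0.
  have y0 : 0 <= 15 / 16 / b%:R :> R by rewrite divr_ge0// ltW.
  have [x [fx xy]] := @least_fixpoint_exists R (F1 b lambda) _
    (@F1_mono R b lambda l0)
    (fun u u0 => ltW (mulr_gt0 (divr_gt0 l0 (addr_gt0 ltr01 l0))
       (@J2_gt0 R b lambda l0 u u0)))
    y0 (@F1_le_subinv R b lambda hb l0 _ y0 (lexx _)).
  by exists x; split=> //; lra.
move=> lambda Y l0 rec bd X m M.
have [s YE] := boundary_hc_orbit _ _ _ hb l0 Y rec bd.
have XE n : X (n + s)%N = (hc_orbit R b lambda n)%:E.
  by rewrite /X YE -EFinB addrAC subrr add0r.
have [m' [M' [om oM ole oge [m0 mM mE ME]]]] := hc_orbit_limits R b lambda l0.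
have [mX MX] := limn_einf_esup_orbit R b lambda l0 X s m' M' XE om oM
  (fun k => proj2 (andP (ole k))) oge.
rewrite /m /M mX MX => mM'; rewrite -EFinB lte_fin.
have {}mM : m' < M'.
  by rewrite lt_neqAle mM andbT; apply/eqP => e; apply: mM'; rewrite e.
have Mb : b%:R^-1 < M'.
  by rewrite -[ltLHS]mulr1 ltr_pdivrMl// (coupled_pair_gt_inv R b lambda hb l0 m').
have mb : m' <= 15 / 16 / b%:R.
  rewrite -(cvg_lim _ om)//; apply: limr_le; first by apply/cvg_ex; exists m'.
  by apply: nearW => k; exact: hc_orbit_even_le.
lra.
Qed.
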